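(* Let $f_1,f_2$ be continuous bundle random dynamical systems on compact metric spaces $X_1,X_2$ over $(\Omega,\mathcal{F},\mathbb{P},\vartheta)$. Let $\mathbf{a}=(a_1,a_2)\in\mathbb{R}^2$ with $a_1>0$ and $a_2\ge0$, and suppose that $f_2$ is a factor of $f_1$ with factor map $\Pi:\Omega\times X_1\to\Omega\times X_2$. Then the function $\omega\mapsto h^{\mathbf a}(\omega,f_1,X_1)$ is measurable on $\Omega$.
   Context: **Base system.** $(\Omega,\mathcal{F},\mathbb{P},\vartheta)$ is a Polish probability space together with an invertible ergodic $\mathbb{P}$-preserving transformation $\vartheta$. **RDS.** Let $X$ be a compact metric space with Borel $\sigma$-algebra $\mathcal{B}$. A continuous bundle random dynamical system (RDS) $f$ on $X$ over $(\Omega,\mathcal{F},\mathbb{P},\vartheta)$ is a family of maps $f_\omega:X\to X$, $\omega\in\Omega$, such that $(\omega,x)\mapsto f_\omega x$ is measurable and $x\mapsto f_\omega x$ is continuous for $\mathbb{P}$-a.e. $\omega$. Put $f_\omega^0=\mathrm{Id}$ and $f_\omega^n=f_{\vartheta^{n-1}\omega}\circ\cdots\circ f_{\vartheta\omega}\circ f_\omega$ for $n>0$. **Factor.** For RDSs $f_1$ on $(X_1,d_1)$ and $f_2$ on $(X_2,d_2)$ over the same base, a factor map is a measurable map $\Pi:\Omega\times X_1\to\Omega\times X_2$ of the form $\Pi(\omega,x)=(\omega,\pi x)$, where $\pi:X_1\to X_2$ is a continuous surjection with $\pi\circ f_{1,\omega}=f_{2,\omega}\circ\pi$ for $\mathbb{P}$-a.e.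 $\omega$; then $f_2$ is called a factor of $f_1$. **Weighted Bowen topological entropy.** $\lceil u\rceil$ is the least integer not less than $u$. For $\omega\in\Omega$, $x\in X_1$, $n\in\mathbb{N}$, $\epsilon>0$, let $B^{\mathbf a}_\omega(x,n,\epsilon)$ be the set of $y\in X_1$ with $d_1(f_{1,\omega}^jx,f_{1,\omega}^jy)<\epsilon$ for $0\le j\le\lceil a_1n\rceil-1$ and $d_2(f_{2,\omega}^j\pi x,f_{2,\omega}^j\pi y)<\epsilon$ for $0\le j\le\lceil(a_1+a_2)n\rceil-1$. For $Z\subseteq X_1$, $s\ge0$, $N\in\mathbb{N}$ let $\Lambda^{\mathbf a,s}_{N,\epsilon}(\omega,Z)=\inf\sum_j\exp(-sn_j)$, the infimum over all countable collections $\{B^{\mathbf a}_\omega(x_j,n_j,\epsilon)\}_j$ with $n_j\ge N$ and $\bigcup_jB^{\mathbf a}_\omega(x_j,n_j,\epsilon)\supseteq Z$. Let $\Lambda^{\mathbf a,s}_\epsilon(\omega,Z)=\lim_{N\to\infty}\Lambda^{\mathbf a,s}_{N,\epsilon}(\omega,Z)$, let $h^{\mathbf a}(\omega,f_1,Z,\epsilon)$ be the critical value of $s$ at which $\Lambda^{\mathbf a,s}_\epsilon(\omega,Z)$ jumps from $\infty$ to $0$, and $h^{\mathbf a}(\omega,f_1,Z)=\lim_{\epsilon\to0}h^{\mathbf a}(\omega,f_1,Z,\epsilon)$.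
   Formalization: ''Measurable on Ω'' is taken with respect to the P-completion of F (the same as F when P is complete); for an incomplete Borel F the claim fails, since f_ω may be arbitrary on a P-null invariant set. *)

(* Defs.v *)
From HB Require Import structures.
From mathcomp Require Import all_boot all_order all_algebra.
From mathcomp Require Import all_classical all_reals all_analysis.
From mathcomp Require Import measurable_realfun.
From mathcomp Require Import ring lra.

Set Implicit Arguments.
Unset Strict Implicit.
Unset Printing Implicit Defensive.
Import Order.TTheory GRing.Theory Num.Theory.
Import numFieldNormedType.Exports.
Local Open Scope classical_set_scope.
Local Open Scope ring_scope.

(* Pointedness is needed because the library's measurable types are pointed. *)
#[short(type="pmetricType")]
HB.structure Definition PointedMetric (R : numDomainType) :=
  { M of Metric R M & isPointed M }.

Definition borel (T : ptopologicalType) := g_sigma_algebraType (@open T).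

(* Omega with the P-completion of its sigma-algebra; when P is complete this
   is the original sigma-algebra, see [measurable_fun_completed]. *)
Definition completed d (Omega : measurableType d) (R : realType)
    (P : probability Omega R) :=
  g_sigma_algebraType (completed_algebra_gen P).

(* The topology of Omega is that of a complete separable metric space S,
   transported along the bijection phi. The sigma-algebra of Omega contains the
   Borel sets and is contained in their P-completion, which covers both usual
   conventions (Borel, or completed Borel). *)
Definition polish_probability d (Omega : measurableType d) (R : realType)
    (P : probability Omega R) : Prop :=
  exists (S : pmetricType R) (phi : Omega -> S),
    [/\ bijective phi,
        forall F : set_system S, ProperFilter F -> cauchy F -> cvg F,
        exists2 D : set S, countable D & dense D,
        forall B : set S, <<s open >> B -> measurable (phi @^-1` B) &
        forall A : set Omega, measurable A ->
          exists B C : set S,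
            [/\ <<s open >> B, <<s open >> C,
                phi @^-1` B `<=` A, A `<=` phi @^-1` C &
                P (phi @^-1` (C `\` B)) = 0%E]].

Definition invertible_measure_preserving d (Omega : measurableType d)
    (R : realType) (P : probability Omega R) (theta : Omega -> Omega) : Prop :=
  [/\ measurable_fun setT theta,
      exists2 theta' : Omega -> Omega,
        measurable_fun setT theta' & cancel theta theta' /\ cancel theta' theta &
      forall A : set Omega, measurable A -> P (theta @^-1` A) = P A].

Definition ergodic d (Omega : measurableType d) (R : realType)
    (P : probability Omega R) (theta : Omega -> Omega) : Prop :=
  forall A : set Omega, measurable A -> theta @^-1` A = A ->
    P A = 0%E \/ P A = 1%E.

Definition continuous_bundle_rds d (Omega : measurableType d) (R : realType)
    (P : probability Omega R) (X : pmetricType R) (f : Omega -> X -> X) : Prop :=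
  measurable_fun setT (fun z : Omega * borel X => f z.1 z.2 : borel X) /\
  {ae P, forall omega, continuous (f omega)}.

Fixpoint rds_iter (Omega X : Type) (theta : Omega -> Omega)
    (f : Omega -> X -> X) (n : nat) (omega : Omega) (x : X) : X :=
  if n is m.+1 then f (iter m theta omega) (rds_iter theta f m omega x) else x.

(* The factor map itself is Pi (omega, x) = (omega, pi x). *)
Definition rds_factor_map d (Omega : measurableType d) (R : realType)
    (P : probability Omega R) (X1 X2 : pmetricType R)
    (f1 : Omega -> X1 -> X1) (f2 : Omega -> X2 -> X2) (pi : X1 -> X2) : Prop :=
  [/\ measurable_fun setT
        (fun z : Omega * borel X1 => (z.1, pi z.2) : Omega * borel X2),
      continuous pi,
      range pi = setT &
      {ae P, forall omega, pi \o f1 omega = f2 omega \o pi}].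

Section weighted_bowen_entropy.
Context {Omega : Type} {R : realType} {X1 X2 : pmetricType R}.
Variables (theta : Omega -> Omega) (f1 : Omega -> X1 -> X1)
  (f2 : Omega -> X2 -> X2) (pi : X1 -> X2) (a1 a2 : R).

Definition weighted_ball (omega : Omega) (x : X1) (n : nat) (eps : R) : set X1 :=
  [set y |
    (forall j : nat, j%:Z <= Num.ceil (a1 * n%:R) - 1 ->
      mdist (rds_iter theta f1 j omega x) (rds_iter theta f1 j omega y) < eps) /\
    (forall j : nat, j%:Z <= Num.ceil ((a1 + a2) * n%:R) - 1 ->
      mdist (rds_iter theta f2 j omega (pi x))
            (rds_iter theta f2 j omega (pi y)) < eps)].

(* A countable collection of balls is a family indexed by a subset J of nat. *)
Definition weighted_cover (omega : Omega) (N : nat) (eps : R) (Z : set X1)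
    (J : set nat) (x : nat -> X1) (n : nat -> nat) : Prop :=
  (forall j, J j -> (N <= n j)%N) /\
  Z `<=` \bigcup_(j in J) weighted_ball omega (x j) (n j) eps.

Definition weighted_outer_at (s : R) (N : nat) (eps : R) (omega : Omega)
    (Z : set X1) : \bar R :=
  ereal_inf [set v | exists J x n, weighted_cover omega N eps Z J x n /\
                      v = \esum_(j in J) (expR (- s * (n j)%:R))%:E].

Definition weighted_outer (s eps : R) (omega : Omega) (Z : set X1) : \bar R :=
  limn (fun N => weighted_outer_at s N eps omega Z).

(* The critical value of s; see [weighted_outer_above] and
   [weighted_outer_below]. It is +oo if weighted_outer never vanishes. *)
Definition weighted_entropy_at (omega : Omega) (Z : set X1) (eps : R) : \bar R :=
  ereal_inf [set s%:E | s in
    [set s : R | 0 <= s /\ weighted_outer s eps omega Z = 0%E]].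

Definition weighted_entropy (omega : Omega) (Z : set X1) : \bar R :=
  lim (weighted_entropy_at omega Z eps @[eps --> 0^'+]).

Local Open Scope ereal_scope.

Lemma weighted_outer_at_ge0 s N eps omega Z :
  0 <= weighted_outer_at s N eps omega Z.
Proof.
apply: le_ereal_inf_tmp => _ [J [x [n [_ ->]]]].
by apply: esum_ge0 => j _; rewrite lee_fin expR_ge0.
Qed.

Lemma weighted_outer_at_nd s eps omega Z :
  nondecreasing_seq (fun N => weighted_outer_at s N eps omega Z).
Proof.
move=> N M NM; apply: ereal_inf_le_tmp => _ [J [x [n [[nM cov] ->]]]].
exists J, x, n; split=> //; split=> // j Jj.
by apply: leq_trans NM _; exact: nM.
Qed.

Lemma weighted_outer_sup s eps omega Z : weighted_outer s eps omega Z =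
  ereal_sup (range (fun N => weighted_outer_at s N eps omega Z)).
Proof.
apply/cvg_lim => //; apply: ereal_nondecreasing_cvgn.
exact: weighted_outer_at_nd.
Qed.

Lemma weighted_outer_ge0 s eps omega Z : 0 <= weighted_outer s eps omega Z.
Proof.
rewrite weighted_outer_sup; apply: le_ereal_sup_tmp.
exists (weighted_outer_at s 0 eps omega Z); first by exists 0%N.
exact: weighted_outer_at_ge0.
Qed.

Lemma weighted_outer_at_le s t N eps omega Z : (s <= t)%R ->
  weighted_outer_at t N eps omega Z <=
  (expR (- (t - s) * N%:R))%:E * weighted_outer_at s N eps omega Z.
Proof.
move=> st; rewrite -lee_pdivrMl ?expR_gt0//.
apply: le_ereal_inf_tmp => _ [J [x [n [cov ->]]]].
rewrite lee_pdivrMl ?expR_gt0//.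
apply: (@le_trans _ _ (\esum_(j in J) (expR (- t * (n j)%:R))%:E)).
  by apply: ereal_inf_lbound; exists J, x, n.
apply: ge_ereal_sup => _ [F [finF FJ] <-].
apply: (@le_trans _ _ ((expR (- (t - s) * N%:R))%:E *
    \sum_(j \in F) (expR (- s * (n j)%:R))%:E)); last first.
  rewrite lee_pmul2l// ?lte_fin ?expR_gt0//.
  by apply: ereal_sup_ubound; exists F.
rewrite ge0_mule_fsumr; last by move=> j; rewrite lee_fin expR_ge0.
apply: lee_fsum => // j Fj; rewrite -EFinM lee_fin -expRD ler_expR.
have : (N%:R <= (n j)%:R :> R)%R by rewrite ler_nat; case: cov => + _; apply; exact: FJ.
by move: st; move: ((n j)%:R : R) (N%:R : R) => u v uv st; nra.
Qed.

Lemma weighted_outer_lt s t eps omega Z : (s < t)%R ->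
  weighted_outer s eps omega Z < +oo -> weighted_outer t eps omega Z = 0.
Proof.
move=> st soo.
have s_fin : weighted_outer s eps omega Z \is a fin_num.
  by rewrite ge0_fin_numE// weighted_outer_ge0.
apply/eqP; rewrite eq_le weighted_outer_ge0 andbT.
set l := fine (weighted_outer s eps omega Z).
have leN N : weighted_outer_at t N eps omega Z <=
    (expR (- (t - s) * N%:R) * l)%:E.
  apply: (le_trans (weighted_outer_at_le _ _ _ _ (ltW st))).
  rewrite EFinM fineK// lee_pmul2l ?lte_fin ?expR_gt0//.
  by rewrite weighted_outer_sup; apply: ereal_sup_ubound; exists N.
have cvg0 : (fun N : nat => (expR (- (t - s) * N%:R) * l)%:E) @ \oo --> 0.
  apply: cvg_EFin; first by apply: nearW.
  rewrite -[X in _ --> X](mul0r l); apply: cvgMr_tmp.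
  rewrite (_ : (fun N : nat => _) = (fun N : nat => expR (- (t - s)) ^+ N)%R).
    apply: cvg_expr; rewrite ger0_norm ?expR_ge0//.
    by rewrite expR_lt1 oppr_lt0 subr_gt0.
  by apply/funext => N; rewrite -expRM_natr.
rewrite -(cvg_lim _ cvg0)//; apply: lee_lim.
- apply: ereal_nondecreasing_is_cvgn; exact: weighted_outer_at_nd.
- by apply: cvgP cvg0.
- exact: nearW.
Qed.

Lemma weighted_outer_below s eps omega Z : (0 <= s)%R ->
  s%:E < weighted_entropy_at omega Z eps -> weighted_outer s eps omega Z = +oo.
Proof.
move=> s0 sh; apply/eqP; rewrite -leye_eq leNgt; apply/negP => soo.
have [t st th] : exists2 t : R, (s < t)%R & t%:E < weighted_entropy_at omega Z eps.
  case: (weighted_entropy_at omega Z eps) sh => [h||//].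
  - rewrite lte_fin => sh; exists ((s + h) / 2)%R; rewrite ?lte_fin; lra.
  - by move=> _; exists (s + 1)%R; rewrite ?ltry//; lra.
suff : weighted_entropy_at omega Z eps <= t%:E by rewrite leNgt th.
apply: ereal_inf_lbound; exists t => //; split; first by lra.
exact: weighted_outer_lt st soo.
Qed.

Lemma weighted_outer_above s eps omega Z :
  weighted_entropy_at omega Z eps < s%:E -> weighted_outer s eps omega Z = 0.
Proof.
move=> /ereal_inf_lt[_ [t [t0 tZ] <-]]; rewrite lte_fin => ts.
by apply: weighted_outer_lt ts _; rewrite tZ ltry.
Qed.

End weighted_bowen_entropy.

Lemma measurable_fun_completed d (Omega : measurableType d) (R : realType)
    (P : probability Omega R) (g : Omega -> \bar R) : measure_is_complete P ->
  measurable_fun [set: completed P] (g : completed P -> \bar R) <->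
  measurable_fun [set: Omega] g.
Proof.
move=> cP.
have E (A : set Omega) : (measurable : set (set (completed P))) A <-> measurable A.
  split; last first.
    move=> mA; apply: sub_sigma_algebra; exists A => //; exists set0.
      exact: negligible_set0.
    by rewrite setU0.
  move: A; apply: smallest_sub; first exact: sigma_algebra_measurable.
  by move=> _ [A mA [N negN <-]]; apply: measurableU => //; exact: cP.
by split=> mg _ B mB; apply/E; exact: mg.
Qed.

(* Main.v *)
Require Import Defs.
From mathcomp Require Import all_boot all_order all_algebra.
From mathcomp Require Import all_classical all_reals all_analysis.
From mathcomp Require Import measurable_realfun.
From mathcomp Require Import finmap lra.

Set Implicit Arguments.
Unset Strict Implicit.
Unset Printing Implicit Defensive.
Import Order.TTheory GRing.Theory Num.Theory.
Local Open Scope classical_set_scope.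
Local Open Scope ring_scope.

(** Compactness reduces everything to countably many conditions on omega, each
about finitely many orbit points, so no measurable projection theorem is
required.

Call omega regular if f1 and f2 are continuous along its whole theta-orbit.
Since theta preserves P, almost every omega is regular
([ae_continuous_orbit]), and on the completed sigma-algebra it is enough to
describe sets of regular omegas ([measurable_completed]).

For regular omega the balls of the covers are open, so a cover of the compact
space X1 may be taken finite. A finite open cover by balls of radius e still
covers after e is replaced by some e - r. The slack r allows the centres to be
moved into a fixed dense sequence z, and it allows covering to be tested on the
points of z only. Hence the outer premeasure at level N is smaller than c if
and only if, for one of countably many pairs (finite list of centres z i with
orders n, slack), the list has small enough weight and every z i lies in one
of the shrunk balls ([net_cover_outer_lt], [outer_lt_net_cover]). For a fixed
pair this is a countable intersection of finite unions of sets
{omega | z i lies in the ball of centre z j}, which are measurable because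
omega |-> f^j_omega x is measurable for each x and X1, X2 are separable
([measurable_weighted_ball]).

The rest is countable limits: N to infinity; then the critical exponent, which
is below r exactly when the outer measure vanishes at some rational exponent
in [0, r[; then e to 0 along 1 / (n + 1), which is legitimate because the
entropy at scale e is monotone in e ([weighted_entropy_cvg]). *)

(** * Separability of compact metric spaces *)

Section metric.
Context {R : realType} (X : pmetricType R).

Lemma open_mdist_lt (x : X) (r : R) : open [set y | mdist x y < r].
Proof.
rewrite openE => y /= xy; apply/nbhs_ballP; exists (r - mdist x y) => /=.
  by rewrite subr_gt0.
by move=> z; rewrite ballEmdist/= => yz; have := metric_triangle x y z; lra.
Qed.

(** The centres of finite (k + 1)^-1-nets, for all k, form a countable dense
set; the pair (k, position in the k-th net) is coded by one integer. *)
Lemma compact_dense_sequence : compact [set: X] ->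
  exists z : nat -> X, dense (range z).
Proof.
rewrite compact_cover => cX.
have net k : exists F : {fset X}, forall y, exists2 x, x \in F & mdist x y < k.+1%:R^-1.
  have [|y _|F _ Fc] := cX X setT (fun x : X => [set y | mdist x y < k.+1%:R^-1]).
  - by move=> x _; exact: open_mdist_lt.
  - by exists y => //=; rewrite mdistxx.
  - by exists F => y; have [x xF xy] := Fc y I; exists x.
have [F netF] := choice net.
exists (fun m => if @choice.unpickle (nat * nat)%type m is Some (k, i) then nth point (F k) i else point).
move=> O [x Ox] oO; have /nbhs_ballP[r /= r0 rO] : nbhs x O by exact: open_nbhs_nbhs.
have [k] := ltr_add_invr r0; rewrite add0r => kr.
have [y yF yx] := netF k x; exists y; split; last first.
  by exists (choice.pickle (k, index y (F k))) => //; rewrite choice.pickleK nth_index.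
by apply: rO; rewrite ballEmdist/= metric_sym; exact: lt_trans yx kr.
Qed.

(** The distance is Borel for the topology of the product X * X, whereas u and v
are only measurable for each factor. Separability bridges the gap: mdist x y < r
holds as soon as some point of the dense sequence is closer than q to x and
closer than r - q to y, for a rational q. *)
Lemma measurable_mdist_lt d (T : measurableType d) (u v : T -> borel X)
    (z : nat -> X) (r : R) : dense (range z) ->
  measurable_fun setT u -> measurable_fun setT v ->
  measurable [set t | mdist (u t : X) (v t : X) < r].
Proof.
move=> dz mu mv.
have mball (w : T -> borel X) x e : measurable_fun [set: T] w ->
    measurable [set t | mdist x (w t : X) < e].
  move=> mw; rewrite -[X in measurable X]setTI.
  apply: (mw measurableT [set y : borel X | mdist x (y : X) < e]).
  by apply: sub_sigma_algebra; exact: open_mdist_lt.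
rewrite (_ : [set t | _] = \bigcup_k \bigcup_(q : rat)
   ([set t | mdist (z k) (u t : X) < ratr q] `&`
    [set t | mdist (z k) (v t : X) < r - ratr q])).
  apply: bigcupT_measurable => k; apply: bigcupT_measurable_rat => q.
  by apply: measurableI; exact: mball.
apply/seteqP; split => [t /= uv|t [k _] [q _] /= [ku kv]]; last first.
  have := metric_triangle (u t : X) (z k) (v t : X); rewrite (metric_sym _ (z k)).
  by lra.
have [||y [uk [k _ kE]]] :=
  dz [set y | mdist (u t : X) y < (r - mdist (u t : X) (v t : X)) / 2].
- by exists (u t) => /=; rewrite mdistxx; lra.
- exact: open_mdist_lt.
rewrite -kE /= in uk.
have [q] : exists q : rat, ratr q \in
    `]mdist (z k) (u t : X), r - mdist (z k) (v t : X)[.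
  apply: rat_in_itvoo; have := metric_triangle (z k) (u t : X) (v t : X).
  by rewrite (metric_sym (z k) (u t : X)); lra.
rewrite in_itv/= => /andP[uq qv]; exists k => //; exists q => //; split => //=.
lra.
Qed.

End metric.

(** * Geometry of weighted Bowen balls *)

Section balls.
Context {Omega : Type} {R : realType} {X1 X2 : pmetricType R}.
Variables (theta : Omega -> Omega) (f1 : Omega -> X1 -> X1)
  (f2 : Omega -> X2 -> X2) (pi : X1 -> X2) (a1 a2 : R).
Implicit Types (omega : Omega) (x y : X1) (n : nat) (e : R).
Local Notation wball := (weighted_ball theta f1 f2 pi a1 a2).

(** A weighted ball is the intersection of two sets of this form, one for each
of the two systems; this allows each property to be proved once. *)
Definition bowen_ball (Y : pmetricType R) (u : nat -> X1 -> Y) (m : nat) x e :=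
  [set y | forall j, (j < m)%N -> mdist (u j x) (u j y) < e].

Lemma le_int_lt_nat (k : int) : exists m : nat, forall j : nat, (j%:Z <= k) = (j < m)%N.
Proof.
case: k => k; [exists k.+1 => j|exists 0%N => j]; last by rewrite ltn0.
by rewrite lez_nat ltnS.
Qed.

(** Integer bounds on the times are turned into natural ones, which makes the
number of conditions visibly finite. *)
Lemma weighted_ballE n : exists m1 m2, forall omega x e,
  wball omega x n e =
    bowen_ball (rds_iter theta f1 ^~ omega) m1 x e `&`
    bowen_ball (fun j => rds_iter theta f2 j omega \o pi) m2 x e.
Proof.
have [m1 m1E] := le_int_lt_nat (Num.ceil (a1 * n%:R) - 1).
have [m2 m2E] := le_int_lt_nat (Num.ceil ((a1 + a2) * n%:R) - 1).
exists m1, m2 => omega x e; apply/seteqP; split => y [].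
- move=> y1 y2; split => j.
    by rewrite -m1E => /y1.
  by rewrite -m2E => /y2.
- move=> y1 y2; split => j.
    by rewrite m1E => /y1.
  by rewrite m2E => /y2.
Qed.

Lemma bowen_ball_open (Y : pmetricType R) (u : nat -> X1 -> Y) m x e :
  (forall j, continuous (u j)) -> open (bowen_ball u m x e).
Proof.
move=> cu; elim: m => [|m IHm].
  by rewrite (_ : bowen_ball _ _ _ _ = setT); [exact: openT|apply/seteqP; split].
rewrite (_ : bowen_ball _ _ _ _ =
    bowen_ball u m x e `&` u m @^-1` [set y | mdist (u m x) y < e]).
  apply: openI => //; apply: open_comp; last exact: open_mdist_lt.
  by move=> y _; exact: cu.
apply/seteqP; split => [y uy|y [uy uym] j] /=.
  by split => [j jm|]; apply: uy; rewrite ?ltnS// ltnW.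
by rewrite ltnS leq_eqVlt => /predU1P[->//|/uy].
Qed.

(** Only finitely many strict inequalities are involved, so they hold with a
common margin. *)
Lemma bowen_ball_shrink (Y : pmetricType R) (u : nat -> X1 -> Y) m x y e :
  0 < e -> bowen_ball u m x e y ->
  exists2 r, 0 < r & bowen_ball u m x (e - r) y.
Proof.
move=> e0; elim: m => [_|m IHm uy]; first by exists 1.
have [|r r0 ur] := IHm; first by move=> j jm; apply: uy; exact: ltnW.
have um : mdist (u m x) (u m y) < e by exact: uy.
pose r' := Num.min r ((e - mdist (u m x) (u m y)) / 2).
have r'r : r' <= r by rewrite ge_min lexx.
have r'm : r' <= (e - mdist (u m x) (u m y)) / 2 by rewrite ge_min lexx orbT.
exists r'; first by rewrite lt_min r0/=; lra.
move=> j; rewrite ltnS leq_eqVlt => /predU1P[->|/ur]; lra.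
Qed.

Lemma weighted_ball_center omega x n e : 0 < e -> wball omega x n e x.
Proof. by move=> e0; split => j _; rewrite mdistxx. Qed.

Lemma weighted_ball_sym omega x y n e :
  wball omega x n e y -> wball omega y n e x.
Proof. by move=> [xy1 xy2]; split => j Hj; rewrite metric_sym; auto. Qed.

Lemma weighted_ball_triangle omega x y z n e e' :
  wball omega x n e y -> wball omega y n e' z -> wball omega x n (e + e') z.
Proof.
move=> [xy1 xy2] [yz1 yz2]; split => j Hj.
  by apply: (le_lt_trans (metric_triangle _ (rds_iter theta f1 j omega y) _));
    rewrite ltrD// ?xy1 ?yz1.
by apply: (le_lt_trans (metric_triangle _ (rds_iter theta f2 j omega (pi y)) _));
    rewrite ltrD// ?xy2 ?yz2.
Qed.

Lemma weighted_ball_le omega x n e e' :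
  e <= e' -> wball omega x n e `<=` wball omega x n e'.
Proof. by move=> ee' y [y1 y2]; split => j Hj; apply: lt_le_trans ee'; auto. Qed.

Lemma weighted_ball_shrink omega x y n e : 0 < e -> wball omega x n e y ->
  exists2 r, 0 < r & wball omega x n (e - r) y.
Proof.
move=> e0; have [m1 [m2 E]] := weighted_ballE n; rewrite E => -[].
move=> /(bowen_ball_shrink e0)[r1 r10 y1] /(bowen_ball_shrink e0)[r2 r20 y2].
exists (Num.min r1 r2); first by rewrite lt_min r10.
by rewrite E; split => j Hj; [have := y1 _ Hj|have := y2 _ Hj]; move/lt_le_trans;
  apply; rewrite lerD2l lerN2 ge_min lexx ?orbT.
Qed.

Definition continuous_orbit omega := forall k,
  continuous (f1 (iter k theta omega)) /\ continuous (f2 (iter k theta omega)).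

Lemma rds_iter_continuous (X : pmetricType R) (f : Omega -> X -> X) omega n :
  (forall k, continuous (f (iter k theta omega))) ->
  continuous (rds_iter theta f n omega).
Proof.
move=> cf; elim: n => [|n IHn] x /=; first exact: cvg_id.
by apply: continuous_comp; [exact: IHn|exact: cf].
Qed.

Lemma weighted_ball_open omega x n e : continuous pi -> continuous_orbit omega ->
  open (wball omega x n e).
Proof.
move=> cpi co; have [m1 [m2 ->]] := weighted_ballE n; apply: openI.
  by apply: bowen_ball_open => j; apply: rds_iter_continuous => k; have [] := co k.
apply: bowen_ball_open => j y; apply: continuous_comp; first exact: cpi.
by apply: rds_iter_continuous => k; have [] := co k.
Qed.

End balls.

(** * Finite covers centred at a dense sequence *)

Section covers.
Context {Omega : Type} {R : realType} {X1 X2 : pmetricType R}.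
Variables (theta : Omega -> Omega) (f1 : Omega -> X1 -> X1)
  (f2 : Omega -> X2 -> X2) (pi : X1 -> X2) (a1 a2 : R).
Variables (z : nat -> X1) (N : nat) (s c e : R).
Local Notation wball := (weighted_ball theta f1 f2 pi a1 a2).
Local Notation outer := (weighted_outer_at theta f1 f2 pi a1 a2).

(** A pair (i, n) in the list l stands for the ball of order n around z i. *)
Definition net_admissible (l : seq (nat * nat)) : bool :=
  all (fun p => N <= p.2)%N l && (\sum_(p <- l) expR (- s * p.2%:R) < c).

(** Covering is demanded only of the dense sequence, but by balls whose radius
has been reduced, which keeps the condition countable and yet sufficient for
covering the whole space. *)
Definition net_cover (l : seq (nat * nat)) (k : nat) (omega : Omega) : Prop :=
  forall i, exists2 p, p \in l & wball omega (z p.1) p.2 (e - k.+1%:R^-1) (z i).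

Hypotheses (e0 : 0 < e) (dz : dense (range z)).
Variable omega : Omega.
Hypotheses (cpi : continuous pi) (co : continuous_orbit theta f1 f2 omega).

(** A point y is approximated by some z i, closely enough for all the orders in
the finite list l at once; the ball that contains z i with slack then
contains y. *)
Lemma net_cover_outer_lt l k : net_admissible l -> net_cover l k omega ->
  (outer s N e omega setT < c%:E)%E.
Proof.
move=> /andP[lN lc] lk; pose pt j := nth (0, 0)%N l j.
apply: (@le_lt_trans _ _ (\sum_(p <- l) expR (- s * p.2%:R))%:E); last first.
  by rewrite lte_fin.
apply: ereal_inf_lbound.
(* The balls are indexed by their positions in the list. *)
exists `I_(size l), (fun j => z (pt j).1), (fun j => (pt j).2); split.
  split => [j /= jl|y _]; first exact: (all_nthP (0, 0)%N lN).
  have close : nbhs y [set y' | forall p, p \in l -> wball omega y p.2 k.+1%:R^-1 y'].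
    elim: l {lN lc lk pt} => [|p l IHl]; first exact: nearW.
    have : nbhs y (wball omega y p.2 k.+1%:R^-1).
      apply: open_nbhs_nbhs; split; first exact: weighted_ball_open.
      by apply: weighted_ball_center.
    apply: filterS2 IHl => y' yl yp q; rewrite inE => /predU1P[->//|]; exact: yl.
  have [y' [+ [i _ ziE]]] : [set y' | forall p, p \in l ->
      wball omega y p.2 k.+1%:R^-1 y']° `&` range z !=set0.
    by apply: dz; [exists y|exact: open_interior].
  rewrite -{y'}ziE => /interior_subset/= yz; have [p pl zz] := lk i.
  exists (index p l); first by rewrite /= index_mem.
  rewrite /pt nth_index// -(subrK k.+1%:R^-1 e).
  by apply: weighted_ball_triangle zz _; apply: weighted_ball_sym; exact: yz.
rewrite esum_fset//.
rewrite -fsbig_ord -sumEFin (big_nth (0, 0)%N) big_mkord.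
by [].
Qed.

(** Compactness is used twice: to extract a finite subfamily from the given
cover, and to find a slack r common to all points. Half of r is spent on moving
the centres into the dense sequence, the other half remains as slack. *)
Lemma outer_lt_net_cover : compact [set: X1] ->
  (outer s N e omega setT < c%:E)%E ->
  exists l k, net_admissible l /\ net_cover l k omega.
Proof.
rewrite compact_cover => cX /ereal_inf_lt[_ [J [x [n [[nN cov] ->]]]] Jc].
(* The first extraction bounds the number of balls. *)
have [|F FJ Fcov] := cX _ J (fun j => wball omega (x j) (n j) e) _ cov.
  by move=> j _; exact: weighted_ball_open.
(* The sets U m increase with m, so a finite subcover gives one slack r. *)
pose U m := \bigcup_(j in [set` F]) wball omega (x j) (n j) (e - m.+1%:R^-1).
have [|y _|M _ Mcov] := cX _ setT U.
- by move=> m _; apply: bigcup_open => j _; exact: weighted_ball_open.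
- have [j Fj /(weighted_ball_shrink e0)[r r0 yr]] := Fcov y I.
  have [m] := ltr_add_invr r0; rewrite add0r => mr.
  exists m => //; exists j => //; apply: weighted_ball_le yr.
  by rewrite lerD2l lerN2 ltW.
pose m := \max_(i <- M) i; pose r : R := m.+1%:R^-1.
have r0 : 0 < r by rewrite invr_gt0.
have UM y : exists2 j, j \in F & wball omega (x j) (n j) (e - r) y.
  have [i iM [j jF yj]] := Mcov y I; exists j => //.
  apply: weighted_ball_le yj; rewrite lerD2l lerN2 lef_pV2 ?posrE//.
  by rewrite ler_nat ltnS /m; exact: leq_bigmax_seq.
have near_net j : exists i, wball omega (x j) (n j) (r / 2) (z i).
  have [||y [+ [i _ ziE]]] := dz (O := wball omega (x j) (n j) (r / 2)).
  - by exists (x j); apply: weighted_ball_center; rewrite divr_gt0.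
  - exact: weighted_ball_open.
  - by rewrite -ziE; exists i.
have [i xi] := choice near_net.
have [k] := ltr_add_invr (divr_gt0 r0 (ltr0Sn R 1)); rewrite add0r => kr.
exists [seq (i j, n j) | j <- F], k; split.
  apply/andP; split.
    apply/allP => _ /mapP[j jF ->] /=; apply: nN.
    by apply: set_mem; exact: FJ.
  rewrite big_map/= -lte_fin; apply: le_lt_trans Jc.
  apply: esum_ge; exists [set` F].
    split; first exact: finite_fset.
    by move=> j /= jF; apply: set_mem; exact: FJ.
  by rewrite -fsbig_seq ?fset_uniq// sumEFin.
move=> p; have [j jF xz] := UM (z p); exists (i j, n j).
  by apply/mapP; exists j.
apply: (@weighted_ball_le _ _ _ _ _ _ _ _ _ _ _ _ _ (r / 2 + (e - r))).
  by move: kr; move: (k.+1%:R^-1 : R) => t kr; lra.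
apply: weighted_ball_triangle xz; exact: weighted_ball_sym.
Qed.

End covers.

(** * Measurability in omega *)

Section measurability.
Context {d : measure_display} {Omega : measurableType d} {R : realType}.

Lemma measurable_iter (theta : Omega -> Omega) k :
  measurable_fun setT theta -> measurable_fun setT (iter k theta).
Proof.
by move=> mt; elim: k => [|k IHk] /=; [exact: measurable_id|exact: measurableT_comp].
Qed.

Lemma measurable_rds_iter (X : pmetricType R) (theta : Omega -> Omega)
    (f : Omega -> X -> X) n x :
  measurable_fun setT theta ->
  measurable_fun setT (fun t : Omega * borel X => f t.1 t.2 : borel X) ->
  measurable_fun setT (fun omega => rds_iter theta f n omega x : borel X).
Proof.
move=> mt mf; elim: n => [|n IHn] /=; first exact: measurable_cst.
apply: (measurableT_comp (g := fun omega => (iter n theta omega,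
  rds_iter theta f n omega x : borel X)) mf).
by apply: measurable_fun_pair => //; exact: measurable_iter.
Qed.

Lemma negligible_preimage_iter (P : probability Omega R) (theta : Omega -> Omega)
    (N : set Omega) k :
  measurable_fun setT theta ->
  (forall A : set Omega, measurable A -> P (theta @^-1` A) = P A) ->
  P.-negligible N -> P.-negligible (iter k theta @^-1` N).
Proof.
move=> mt Pt negN; elim: k => [//|k [B [mB B0 NB]]].
exists (theta @^-1` B); split.
- by rewrite -[X in measurable X]setTI; exact: mt.
- by rewrite Pt.
- by move=> omega; rewrite /= -iterS iterSr => /NB.
Qed.

(** The exceptional set is the union of the preimages under the iterates of
theta of one null set. *)
Lemma ae_continuous_orbit (P : probability Omega R) (X1 X2 : pmetricType R)
    (theta : Omega -> Omega) (f1 : Omega -> X1 -> X1) (f2 : Omega -> X2 -> X2) :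
  measurable_fun setT theta ->
  (forall A : set Omega, measurable A -> P (theta @^-1` A) = P A) ->
  {ae P, forall omega, continuous (f1 omega)} ->
  {ae P, forall omega, continuous (f2 omega)} ->
  {ae P, forall omega, continuous_orbit theta f1 f2 omega}.
Proof.
move=> mt Pt c1 c2.
have c12 : {ae P, forall omega, continuous (f1 omega) /\ continuous (f2 omega)}.
  by apply: filterS2 c1 c2.
have := negligible_bigcup (fun k => negligible_preimage_iter k mt Pt c12).
apply: negligibleS => omega /= /existsNP[k nk]; exists k => //.
Qed.

(** S and A differ only inside a null set, and every subset of a null set is
measurable for the completion. *)
Lemma measurable_completed (P : probability Omega R) (G : Omega -> Prop)
    (A S : set Omega) : {ae P, forall omega, G omega} -> measurable A ->
  (forall omega, G omega -> S omega <-> A omega) ->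
  measurable (S : set (completed P)).
Proof.
move=> [B [mB B0 GB]] mA SA; apply: sub_sigma_algebra.
exists (A `\` B); first exact: measurableD.
exists (S `&` B); first by exists B; split.
apply/seteqP; split => omega.
  case=> [[Aw nB]|[]//]; apply/SA => //; apply: contrapT => nG; exact/nB/GB.
move=> Sw; have [Bw|nB] := pselect (B omega); [by right|left; split => //].
by apply/SA => //; apply: contrapT => nG; exact/nB/GB.
Qed.

Context {X1 X2 : pmetricType R}.
Variables (theta : Omega -> Omega) (f1 : Omega -> X1 -> X1)
  (f2 : Omega -> X2 -> X2) (pi : X1 -> X2) (a1 a2 : R).
Hypotheses (mtheta : measurable_fun setT theta)
  (mf1 : measurable_fun setT (fun t : Omega * borel X1 => f1 t.1 t.2 : borel X1))
  (mf2 : measurable_fun setT (fun t : Omega * borel X2 => f2 t.1 t.2 : borel X2))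
  (cX1 : compact [set: X1]) (cX2 : compact [set: X2]).

Lemma measurable_weighted_ball x n e y :
  measurable [set omega | weighted_ball theta f1 f2 pi a1 a2 omega x n e y].
Proof.
have [m1 [m2 E]] := weighted_ballE theta f1 f2 pi a1 a2 n.
have [z1 dz1] := compact_dense_sequence cX1.
have [z2 dz2] := compact_dense_sequence cX2.
rewrite (_ : [set omega | _] =
  \bigcap_(j in `I_m1) [set omega |
    mdist (rds_iter theta f1 j omega x) (rds_iter theta f1 j omega y) < e] `&`
  \bigcap_(j in `I_m2) [set omega |
    mdist (rds_iter theta f2 j omega (pi x)) (rds_iter theta f2 j omega (pi y)) < e]).
  apply: measurableI; apply: fin_bigcap_measurable => // j _.
    by apply: (measurable_mdist_lt _ dz1); exact: measurable_rds_iter.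
  by apply: (measurable_mdist_lt _ dz2); exact: measurable_rds_iter.
by apply/seteqP; split => omega /=; rewrite E.
Qed.

Lemma measurable_net_cover z e l k :
  measurable [set omega | net_cover theta f1 f2 pi a1 a2 z e l k omega].
Proof.
rewrite (_ : [set omega | _] = \bigcap_i \bigcup_(p in [set` l])
    [set omega | weighted_ball theta f1 f2 pi a1 a2 omega (z p.1) p.2
       (e - k.+1%:R^-1) (z i)]).
  apply: bigcapT_measurable => i; apply: fin_bigcup_measurable => //.
  by move=> p _; exact: measurable_weighted_ball.
apply/seteqP; split => omega.
  by move=> C i _; have [p] := C i; exists p.
by move=> C i; have [p] := C i I; exists p.
Qed.

Variable P : probability Omega R.
Hypotheses (Ptheta : forall A : set Omega, measurable A -> P (theta @^-1` A) = P A)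
  (cpi : continuous pi)
  (aeco : {ae P, forall omega, continuous_orbit theta f1 f2 omega}).

(** The sets where the function is smaller than c are, up to a null set,
countable unions over the lists l and the slacks k. *)
Lemma measurable_weighted_outer_at s N e : 0 < e ->
  measurable_fun setT (fun omega : completed P =>
    weighted_outer_at theta f1 f2 pi a1 a2 s N e (omega : Omega) setT).
Proof.
move=> e0; apply: (measurability _ (ErealGenInftyO.measurableE R)).
move=> _ [_ [c ->] <-]; rewrite setTI.
have [z dz] := compact_dense_sequence cX1.
pose A := \bigcup_(lk : seq (nat * nat) * nat)
  [set omega | net_admissible N s c lk.1 /\
               net_cover theta f1 f2 pi a1 a2 z e lk.1 lk.2 omega].
apply: (measurable_completed (A := A) aeco).
  apply: countable_bigcupT_measurable => // -[l k] /=.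
  have [lc|lc] := pselect (net_admissible N s c l).
    rewrite (_ : [set omega | _] =
        [set omega | net_cover theta f1 f2 pi a1 a2 z e l k omega]).
      exact: measurable_net_cover.
    by apply/seteqP; split => omega // -[].
  rewrite (_ : [set omega | _] = set0); first exact: measurable0.
  by apply/seteqP; split => omega // -[].
move=> omega co /=; rewrite in_itv /=; split.
  by move=> /(outer_lt_net_cover e0 dz cpi co cX1)[l [k lk]]; exists (l, k).
by move=> [[l k] _ [lc lk]]; exact: (net_cover_outer_lt dz cpi co lc lk).
Qed.

Lemma measurable_weighted_outer s e : 0 < e ->
  measurable_fun setT (fun omega : completed P =>
    weighted_outer theta f1 f2 pi a1 a2 s e (omega : Omega) setT).
Proof.
move=> e0; apply: emeasurable_fun_cvg.
  by move=> N; exact: (measurable_weighted_outer_at s N e0).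
move=> omega _ /=; rewrite weighted_outer_sup.
by apply: ereal_nondecreasing_cvgn; exact: weighted_outer_at_nd.
Qed.

(** The outer measure vanishes for all exponents above one at which it vanishes,
so the infimum that defines the entropy may be tested on rational exponents. *)
Lemma measurable_weighted_entropy_at e : 0 < e ->
  measurable_fun setT (fun omega : completed P =>
    weighted_entropy_at theta f1 f2 pi a1 a2 (omega : Omega) setT e).
Proof.
move=> e0; apply: (measurability _ (ErealGenInftyO.measurableE R)).
move=> _ [_ [r ->] <-]; rewrite setTI.
rewrite (_ : _ @^-1` _ = \bigcup_(q : rat) [set omega : completed P |
    (0 <= (ratr q : R) < r) /\
    (weighted_outer theta f1 f2 pi a1 a2 (ratr q) e (omega : Omega) setT <= 0)%E]).
  apply: bigcupT_measurable_rat => q.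
  have [qr|qr] := pselect (0 <= (ratr q : R) < r).
    rewrite (_ : [set omega : completed P | _] = setT `&` [set omega : completed P |
      (weighted_outer theta f1 f2 pi a1 a2 (ratr q) e (omega : Omega) setT <= 0)%E]).
      by apply: emeasurable_fun_infty_c => //; exact: measurable_weighted_outer.
    by apply/seteqP; split => omega // -[].
  rewrite (_ : [set omega | _] = set0); first exact: measurable0.
  by apply/seteqP; split => omega // -[].
apply/seteqP; split => omega /=; rewrite in_itv /=.
  move=> /ereal_inf_lt[_ [s [s0 sZ] <-]]; rewrite lte_fin => sr.
  have [q] := rat_in_itvoo sr; rewrite in_itv /= => /andP[sq qr].
  exists q => //; split; first by rewrite qr andbT (le_trans s0)// ltW.
  by rewrite (weighted_outer_lt sq)// sZ ltry.
move=> [q _ [/andP[q0 qr] qZ]]; apply: (@le_lt_trans _ _ (ratr q)%:E).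
  apply: ereal_inf_lbound; exists (ratr q) => //; split=> //.
  by apply/eqP; rewrite eq_le qZ weighted_outer_ge0.
by rewrite lte_fin.
Qed.

End measurability.

(** * The limit of small scales *)

Section eps_limit.
Context {Omega : Type} {R : realType} {X1 X2 : pmetricType R}.
Variables (theta : Omega -> Omega) (f1 : Omega -> X1 -> X1)
  (f2 : Omega -> X2 -> X2) (pi : X1 -> X2) (a1 a2 : R).

(** Smaller balls give fewer covers, hence a larger outer measure. *)
Lemma weighted_entropy_at_ni omega Z e e' : e <= e' ->
  (weighted_entropy_at theta f1 f2 pi a1 a2 omega Z e' <=
   weighted_entropy_at theta f1 f2 pi a1 a2 omega Z e)%E.
Proof.
move=> ee'; apply: ereal_inf_le_tmp => _ [s [s0 sZ] <-]; exists s => //; split => //.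
apply/eqP; rewrite eq_le weighted_outer_ge0 andbT -sZ !weighted_outer_sup.
apply: ge_ereal_sup => _ [N _ <-].
apply: le_ereal_sup_tmp; exists (weighted_outer_at theta f1 f2 pi a1 a2 s N e omega Z).
  by exists N.
apply: ereal_inf_le_tmp => _ [J [x [n [[nN cov] ->]]]].
exists J, x, n; split => //; split => // y /cov[j Jj yj]; exists j => //.
exact: weighted_ball_le yj.
Qed.

(** Monotonicity in the scale guarantees that the one-sided limit at 0 exists,
so that it may be computed along a sequence. *)
Lemma weighted_entropy_cvg omega Z :
  weighted_entropy_at theta f1 f2 pi a1 a2 omega Z n.+1%:R^-1 @[n --> \oo] -->
  weighted_entropy theta f1 f2 pi a1 a2 omega Z.
Proof.
have h : cvg (weighted_entropy_at theta f1 f2 pi a1 a2 omega Z e @[e --> 0^'+]).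
  apply/cvg_ex; eexists; apply: (nonincreasing_at_right_cvge (BInfty _ false)) => //.
  by move=> e e' _ _; exact: weighted_entropy_at_ni.
apply: cvg_comp h => A A0.
have : \forall n \near \oo, 0 < @harmonic R n -> A (harmonic n).
  exact: (@cvg_harmonic R _ A0).
by apply: filterS => n; apply; exact: harmonic_gt0.
Qed.

End eps_limit.

(** * Measurability of the weighted entropy *)

Theorem theorem3p1 (R : realType) (d : measure_display)
    (Omega : measurableType d) (P : probability Omega R)
    (theta : Omega -> Omega) (X1 X2 : pmetricType R)
    (f1 : Omega -> X1 -> X1) (f2 : Omega -> X2 -> X2) (pi : X1 -> X2)
    (a1 a2 : R) :
  polish_probability P ->
  invertible_measure_preserving P theta ->
  ergodic P theta ->
  compact [set: X1] ->
  compact [set: X2] ->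
  continuous_bundle_rds P f1 ->
  continuous_bundle_rds P f2 ->
  0 < a1 ->
  0 <= a2 ->
  rds_factor_map P f1 f2 pi ->
  measurable_fun [set: completed P]
    (fun omega : completed P =>
      weighted_entropy theta f1 f2 pi a1 a2 (omega : Omega) [set: X1]).
Proof.
move=> _ [mtheta _ Ptheta] _ cX1 cX2 [mf1 cf1] [mf2 cf2] _ _ [_ cpi _ _].
have aeco := ae_continuous_orbit mtheta Ptheta cf1 cf2.
apply: emeasurable_fun_cvg => [k|omega _]; last exact: weighted_entropy_cvg.
by apply: measurable_weighted_entropy_at.
Qed.
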